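(* Let $I_0(q,t)=1$, for $n\ge1$ let $I_n(q,t)=\sum_{\pi\in\mathcal{S}_n(\underline{32}1)}q^{\mathrm{inv}(\pi)}t^{\mathrm{des}(\pi)}$, and let $I(q,t;x)=\sum_{n=0}^{\infty}I_n(q,t)\frac{x^n}{n!_q}$. Then $$I(q,t;x)=\prod_{k=0}^{\infty}\left(\left[t\left(\exp_q(q^{k+1}x)-1\right)+1\right](q-1)q^kx+1\right)^{-1}.$$
   Context: $\mathcal{S}_n$ is the set of permutations $\pi=\pi_1\pi_2\cdots\pi_n$ of $[n]=\{1,\dots,n\}$. A permutation $\pi\in\mathcal{S}_n$ contains the vincular pattern $\underline{32}1$ if there are indices $i,j$ with $1\le i$, $i+1<j\le n$ and $\pi_i>\pi_{i+1}>\pi_j$ (the entries playing the roles of 3 and 2 must be adjacent); otherwise it avoids it. $\mathcal{S}_n(\underline{32}1)$ is the set of $\pi\in\mathcal{S}_n$ avoiding $\underline{32}1$. The inversion number is $\mathrm{inv}(\pi)=|\{(i,j): i<j,\ \pi_i>\pi_j\}|$. An index $i\in[n-1]$ is a descent of $\pi$ if $\pi_i>\pi_{i+1}$, and $\mathrm{des}(\pi)$ is the number of descents of $\pi$. $q$-notation: $[n]_q=\frac{1-q^n}{1-q}$, $0!_q=1$, $n!_q=\prod_{k=1}^n[k]_q$ for $n\ge1$, and $\exp_q(x)=\sum_{n=0}^\infty\frac{x^n}{n!_q}$. The identity is one of formal power series in $x$, whose coefficients may be regarded as elements of $\mathbb{Z}[t][[q]]$ (note that each $n!_q$ has constant term $1$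 in $q$); the infinite product is understood as a limit in the formal power series topology of $\mathbb{Z}[t][[q]][[x]]$. *)

(* Defs.v *)
From HB Require Import structures.
From mathcomp Require Import all_boot all_order all_algebra all_fingroup.
From mathcomp Require Import boolp.

Set Implicit Arguments.
Unset Strict Implicit.
Unset Printing Implicit Defensive.

Import GRing.Theory.
Local Open Scope ring_scope.

(* Formal power series in one variable over R, i.e. R[[X]], with the Cauchy
   product; iterating gives R[[q]][[x]] as {fps {fps R}}. *)

Record fps (R : Type) := FPS { fps_coef : nat -> R }.

Notation "{ 'fps' R }" := (fps R) (format "{ 'fps'  R }") : type_scope.
Notation "\fps_ n E" := (FPS (fun n : nat => E))
  (at level 36, n name, E at level 36, format "\fps_ n  E") : ring_scope.

Lemma fpsP (R : Type) (f g : {fps R}) : fps_coef f =1 fps_coef g -> f = g.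
Proof. by case: f g => [f] [g] /= /funext ->. Qed.

HB.instance Definition _ (R : Type) := gen_eqMixin {fps R}.
HB.instance Definition _ (R : Type) := gen_choiceMixin {fps R}.

Section Zmodule.
Variable R : zmodType.
Implicit Types f g h : {fps R}.

Definition fps_zero : {fps R} := \fps_n 0.
Definition fps_opp f : {fps R} := \fps_n (- fps_coef f n).
Definition fps_add f g : {fps R} := \fps_n (fps_coef f n + fps_coef g n).

Fact fps_addA : associative fps_add.
Proof. by move=> f g h; apply: fpsP => n /=; rewrite addrA. Qed.
Fact fps_addC : commutative fps_add.
Proof. by move=> f g; apply: fpsP => n /=; rewrite addrC. Qed.
Fact fps_add0 : left_id fps_zero fps_add.
Proof. by move=> f; apply: fpsP => n /=; rewrite add0r. Qed.
Fact fps_addN : left_inverse fps_zero fps_opp fps_add.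
Proof. by move=> f; apply: fpsP => n /=; rewrite addNr. Qed.

HB.instance Definition _ :=
  GRing.isZmodule.Build {fps R} fps_addA fps_addC fps_add0 fps_addN.

Lemma fps_coef0 n : fps_coef (0 : {fps R}) n = 0. Proof. by []. Qed.
Lemma fps_coefN f n : fps_coef (- f) n = - fps_coef f n. Proof. by []. Qed.
Lemma fps_coefD f g n : fps_coef (f + g) n = fps_coef f n + fps_coef g n.
Proof. by []. Qed.

End Zmodule.

Section Ring.
Variable R : comNzRingType.
Implicit Types f g h : {fps R}.

Definition fpsC (c : R) : {fps R} := \fps_n (if n == 0%N then c else 0).
Definition fpsX : {fps R} := \fps_n (n == 1%N)%:R.
Definition fps_mul f g : {fps R} :=
  \fps_n (\sum_(i < n.+1) fps_coef f i * fps_coef g (n - i)%N).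

Fact fps_mulC : commutative fps_mul.
Proof.
move=> f g; apply: fpsP => n /=.
rewrite (reindex_inj rev_ord_inj) /=; apply: eq_bigr => i _.
by rewrite mulrC subSS subKn // -ltnS.
Qed.

Fact fps_mulA : associative fps_mul.
Proof.
have rev f g n : \sum_(i < n.+1) fps_coef f i * fps_coef g (n - i)%N =
    \sum_(i < n.+1) fps_coef f (n - i)%N * fps_coef g i.
  have := congr1 (fun f => fps_coef f n) (fps_mulC f g) => /= ->.
  by apply: eq_bigr => i _; rewrite mulrC.
move=> f g h; apply: fpsP => n /=; rewrite [RHS](rev (fps_mul f g) h).
pose c j k := fps_coef f j * (fps_coef g (n - j - k)%N * fps_coef h k).
transitivity (\sum_(j < n.+1) \sum_(k < n.+1 | (k <= n - j)%N) c j k).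
  apply: eq_bigr => /= j _; rewrite rev big_distrr /=.
  by rewrite (big_ord_narrow_leq (leq_subr _ _)).
rewrite (exchange_big_dep predT) //=; apply: eq_bigr => k _.
transitivity (\sum_(j < n.+1 | (j <= n - k)%N) c j k).
  apply: eq_bigl => j; rewrite -ltnS -(ltnS j) -!subSn ?leq_ord //.
  by rewrite -subn_gt0 -(subn_gt0 j) -!subnDA addnC.
rewrite (big_ord_narrow_leq (leq_subr _ _)) big_distrl /=.
by apply: eq_bigr => j _; rewrite /c -!subnDA addnC mulrA.
Qed.

Fact fps_mul1 : left_id (fpsC 1) fps_mul.
Proof.
move=> f; apply: fpsP => n /=.
by rewrite big_ord_recl /= mul1r subn0 big1 ?addr0 // => i _; rewrite mul0r.
Qed.

Fact fps_mulD : left_distributive fps_mul +%R.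
Proof.
move=> f g h; apply: fpsP => n /=; rewrite -big_split /=.
by apply: eq_bigr => i _; rewrite mulrDl.
Qed.

Fact fps_1neq0 : fpsC 1 != 0.
Proof.
by apply/eqP => /(congr1 (fun f => fps_coef f 0)) /= /eqP; rewrite oner_eq0.
Qed.

HB.instance Definition _ := GRing.Zmodule_isComNzRing.Build {fps R}
  fps_mulA fps_mulC fps_mul1 fps_mulD fps_1neq0.

Lemma fps_coef1 n : fps_coef (1 : {fps R}) n = (n == 0%N)%:R.
Proof. by case: n. Qed.

Lemma fps_coefM f g n :
  fps_coef (f * g) n = \sum_(i < n.+1) fps_coef f i * fps_coef g (n - i)%N.
Proof. by []. Qed.

(* the series f(cX) *)
Definition fps_scale_var (c : R) f : {fps R} := \fps_n (c ^+ n * fps_coef f n).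

End Ring.

Arguments fpsX {R}.

Section UnitRing.
Variable R : comUnitRingType.
Implicit Types f g h : {fps R}.

(* the first n + 1 coefficients of f^-1, by the usual recursion *)
Fixpoint fps_inv_seq f n : seq R :=
  if n is m.+1 then
    let s := fps_inv_seq f m in
    rcons s
      (- (fps_coef f 0)^-1 * \sum_(i < m.+1) fps_coef f i.+1 * s`_(m - i))
  else [:: (fps_coef f 0)^-1].

Definition fps_unit : pred {fps R} :=
  [pred f | fps_coef f 0 \is a GRing.unit].
Definition fps_inv f : {fps R} :=
  if f \in fps_unit then \fps_n (fps_inv_seq f n)`_n else f.

Lemma size_fps_inv_seq f n : size (fps_inv_seq f n) = n.+1.
Proof. by elim: n => //= n IHn; rewrite size_rcons IHn. Qed.

Lemma nth_fps_inv_seq f n m :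
  (m <= n)%N -> (fps_inv_seq f n)`_m = (fps_inv_seq f m)`_m.
Proof.
elim: n => [|n IHn]; first by rewrite leqn0 => /eqP ->.
rewrite leq_eqVlt => /predU1P[-> //|].
by rewrite ltnS /= nth_rcons size_fps_inv_seq ltnS => le_mn; rewrite le_mn IHn.
Qed.

Fact fps_mulV : {in fps_unit, left_inverse 1 fps_inv *%R}.
Proof.
move=> f Uf; rewrite mulrC /fps_inv Uf; apply: fpsP => n.
rewrite fps_coef1 fps_coefM.
case: n => [|n]; first by rewrite big_ord1 /= divrr.
rewrite big_ord_recl subn0 /= nth_rcons size_fps_inv_seq ltnn eqxx.
rewrite mulrA mulrN divrr // mulN1r; apply/eqP; rewrite addrC subr_eq0; apply/eqP.
apply: eq_bigr => i _; rewrite /bump /= add1n subSS.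
by rewrite (@nth_fps_inv_seq f n) ?leq_subr.
Qed.

Fact fps_unitP f g : g * f = 1 -> f \in fps_unit.
Proof.
move/(congr1 (fun f => fps_coef f 0)); rewrite fps_coefM big_ord1 /= => gf1.
by apply/unitrPr; exists (fps_coef g 0); rewrite mulrC.
Qed.

Fact fps_inv_out : {in [predC fps_unit], fps_inv =1 id}.
Proof. by move=> f /negPf Uf; rewrite /fps_inv [_ \in _]Uf. Qed.

HB.instance Definition _ := GRing.ComNzRing_hasMulInverse.Build {fps R}
  fps_mulV fps_unitP fps_inv_out.

Lemma fps_unitE f : (f \is a GRing.unit) = (fps_coef f 0 \is a GRing.unit).
Proof. by []. Qed.

End UnitRing.

(* Convergence of sequences, relative to a notion of convergence of sequences
   of coefficients: [fps_cvg (eventually_eq (T := R))] is convergence in R[[q]]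
   with R discrete, and [fps2_cvg] is convergence in R[[q]][[x]]. *)

Definition eventually_eq (T : Type) (u : nat -> T) (l : T) : Prop :=
  exists N : nat, forall k : nat, (N <= k)%N -> u k = l.

Definition fps_cvg (T : Type) (cvgT : (nat -> T) -> T -> Prop)
    (u : nat -> {fps T}) (l : {fps T}) : Prop :=
  forall n : nat, cvgT (fun k => fps_coef (u k) n) (fps_coef l n).

Definition fps2_cvg (T : Type) (u : nat -> {fps {fps T}}) (l : {fps {fps T}}) :=
  fps_cvg (fps_cvg (@eventually_eq T)) u l.

Lemma fps2_cvg_unique (T : Type) (u : nat -> {fps {fps T}}) l1 l2 :
  fps2_cvg u l1 -> fps2_cvg u l2 -> l1 = l2.
Proof.
move=> ul1 ul2; apply: fpsP => n; apply: fpsP => m.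
have [N1 uN1] := ul1 n m; have [N2 uN2] := ul2 n m.
by rewrite -(uN1 (maxn N1 N2)) ?leq_maxl // uN2 ?leq_maxr.
Qed.

Section QNotation.
Variable R : comUnitRingType.
Implicit Types (q : R) (n : nat).

Definition qint q n : R := (1 - q ^+ n) / (1 - q).
Definition qfact q n : R := \prod_(1 <= k < n.+1) qint q k.
Definition qexp q : {fps R} := \fps_n (qfact q n)^-1.

End QNotation.

(* Permutations act on {0, ..., n-1} instead of {1, ..., n}. *)

Section Permutations.
Variable n : nat.
Implicit Types (s : 'S_n) (i j : 'I_n).

Definition contains_v321 s : bool :=
  [exists i : 'I_n, exists i' : 'I_n, exists j : 'I_n,
    [&& i' == i.+1 :> nat, (i' < j)%N, (s i' < s i)%N & (s j < s i')%N]].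

Definition inv_perm s : nat :=
  #|[set ij : 'I_n * 'I_n | (ij.1 < ij.2)%N && (s ij.2 < s ij.1)%N]|.

Definition des_perm s : nat :=
  #|[set i : 'I_n | [exists i' : 'I_n,
      (i' == i.+1 :> nat) && (s i' < s i)%N]]|.

End Permutations.

(* Z[t][[q]], its elements q and t, and Z[t][[q]][[x]] *)
Notation Ztq := {fps {poly int}}.
Notation Ztqx := {fps {fps {poly int}}}.
Definition q_ : Ztq := fpsX.
Definition t_ : Ztq := fpsC 'X.
Definition x_ : Ztqx := fpsX.

Definition I_poly (n : nat) : Ztq :=
  if n is 0%N then 1
  else \sum_(s : 'S_n | ~~ contains_v321 s) q_ ^+ inv_perm s * t_ ^+ des_perm s.

Definition I_series : Ztqx := \fps_n (I_poly n / qfact q_ n).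

(* Main.v *)
Require Import Defs.
From mathcomp Require Import all_boot all_order all_algebra.
From mathcomp Require Import all_fingroup ring zify.
Import GRing.Theory.
Local Open Scope ring_scope.

Set Implicit Arguments.
Unset Strict Implicit.
Unset Printing Implicit Defensive.

(** The product telescopes.  Let [D_0] be the [k = 0] factor, before inversion;
    the factor of index [k] is [D_0(q^k x)].  If [I] satisfies the functional
    equation
      [D_0(x) I(x) = I(q x)],
    then the inverses of the first [K] factors multiply [I(q^K x)] into [I(x)]
    ([partial_product_mul_I]).  As [I] has constant term 1, the series
    [I(q^K x)] is 1 modulo [q^K], so the partial product agrees with [I(x)]
    modulo [q^K], and the infinite product converges to [I].

    Comparing coefficients of [x^(n+1)], the functional equation says that
      [I_(n+1) = (1 - t) I_n + t sum_k q^k binom(n, k)_q I_(n-k)]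
    ([I_poly_rec]).  In words: the values before the minimum of an avoiding
    permutation must increase, since any descent among them would be completed
    by the minimum; choosing these [k] values gives [q^k binom(n, k)_q], the
    minimum ends a descent unless [k = 0], and what follows it is an arbitrary
    avoiding permutation.

    The recurrence is derived through Lehmer codes, which turn the choice of a
    set of values into a one-letter-at-a-time recursion.  Removing the first
    letter [j] of a permutation and standardizing the rest lowers the number of
    inversions by [j], and whether the removed letter started a descent or an
    occurrence of the pattern depends only on [j] and on the new first letter
    [b]: there was a descent iff [b < j], and an occurrence iff [0 < b < j].
    The generating function with a prescribed letter [a] in front
    ([avoid_gf n a]) hence obeys a linear recursion in [n] and [a], and the
    q-Pascal rule gives its closed form for [a > 0] ([avoid_gf_pos]). *)

(** * Removing the first letter of a permutation *)

(** The empty permutation gets the value 0: the only letter that can be put in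
    front of it is 0, which then starts no descent, as it should. *)
Definition first_value n : 'S_n -> nat :=
  if n is m.+1 return 'S_n -> nat then fun s => s ord0 else fun=> 0%N.

Lemma existsb_false (T : finType) : [exists x : T, false] = false.
Proof. by apply/existsP => -[]. Qed.

Lemma exists_ord_recl n (P : pred 'I_n.+1) :
  [exists i, P i] = P ord0 || [exists i : 'I_n, P (lift ord0 i)].
Proof.
apply/existsP/orP => [[i]|[P0|/existsP[i Pi]]]; last 2 first.
- by exists ord0.
- by exists (lift ord0 i).
by case: (unliftP ord0 i) => [j|] -> Pi; [right; apply/existsP; exists j | left].
Qed.

Lemma lift_perm_bij n :
  bijective (fun js : 'I_n.+1 * 'S_n => lift_perm ord0 js.1 js.2).
Proof.
apply: inj_card_bij => [[j s] [j' s'] /= /permP eq_js|]; last first.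
  by rewrite card_prod !card_Sn card_ord factS.
have eq_j: j = j' by have := eq_js ord0; rewrite !lift_perm_id.
congr (_, _) => //; apply/permP => i; apply: (@lift_inj _ j).
by have := eq_js (lift ord0 i); rewrite !lift_perm_lift -eq_j.
Qed.

Lemma ltn_lift n (h : 'I_n.+1) (i j : 'I_n) : (lift h i < lift h j)%N = (i < j)%N.
Proof. by rewrite /= /bump; do 2!case: leqP => /=; lia. Qed.

Lemma ltn_lift_id n (h : 'I_n.+1) (i : 'I_n) : (lift h i < h)%N = (i < h)%N.
Proof. by rewrite /= /bump; case: leqP => /=; lia. Qed.

Lemma inv_permE n (s : 'S_n) :
  inv_perm s = (\sum_(i : 'I_n) \sum_(j : 'I_n) ((i < j) && (s j < s i)))%N.
Proof.
rewrite /inv_perm cardsE -sum1_card big_mkcond /= pair_big /=.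
by apply: eq_bigr => -[i j] _; rewrite unfold_in /=; case: (_ && _).
Qed.

(** The first letter [j] is larger than exactly [j] of the other ones. *)
Lemma inv_lift_perm n (j : 'I_n.+1) (s : 'S_n) :
  inv_perm (lift_perm ord0 j s) = (j + inv_perm s)%N.
Proof.
rewrite !inv_permE big_ord_recl; congr (_ + _)%N; last first.
  apply: eq_bigr => i _; rewrite big_ord_recl /= add0n.
  by apply: eq_bigr => k _; rewrite !lift_perm_lift ltn_lift.
rewrite big_ord_recl /= add0n.
under eq_bigr => k _ do rewrite lift_perm_id lift_perm_lift ltn_lift_id.
rewrite (reindex_inj (@perm_inj _ s^-1%g)) /=.
under eq_bigr => k _ do rewrite permKV.
rewrite -big_mkcond sum1_card /=.
have le_jn: (j <= n)%N by rewrite -ltnS.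
rewrite -[RHS]card_ord -sum1_card (big_ord_narrow le_jn) -sum1_card.
by apply: eq_bigl.
Qed.

Lemma des_permE n (s : 'S_n) :
  des_perm s =
    (\sum_(i : 'I_n)
       [exists i' : 'I_n, (i' == i.+1 :> nat) && (s i' < s i)%N])%N.
Proof.
rewrite /des_perm cardsE -sum1_card big_mkcond /=.
by apply: eq_bigr => i _; rewrite unfold_in; case: [exists _, _].
Qed.

Lemma des_lift_perm n (j : 'I_n.+1) (s : 'S_n) :
  des_perm (lift_perm ord0 j s) = ((first_value s < j) + des_perm s)%N.
Proof.
rewrite !des_permE big_ord_recl; congr (_ + _)%N; last first.
  apply: eq_bigr => i _; rewrite exists_ord_recl /=.
  by congr (nat_of_bool _); apply: eq_existsb => k; rewrite !lift_perm_lift ltn_lift.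
rewrite exists_ord_recl /= lift_perm_id; congr (nat_of_bool _).
case: n j s => [|n] j s; first by rewrite [j]ord1 ltn0; apply/existsP => -[[]].
rewrite exists_ord_recl lift_perm_lift ltn_lift_id /= orbC.
by case: existsP => // -[k]; rewrite /bump.
Qed.

(** A descent from the first letter completes to the pattern iff its bottom is
    not the smallest of the remaining letters, that is, iff the bottom is
    nonzero after standardization. *)
Lemma contains_lift_perm n (j : 'I_n.+1) (s : 'S_n) :
  contains_v321 (lift_perm ord0 j s) =
    (0 < first_value s < j)%N || contains_v321 s.
Proof.
rewrite /contains_v321 exists_ord_recl; congr (_ || _); last first.
  apply: eq_existsb => i; rewrite exists_ord_recl /= existsb_false /=.
  apply: eq_existsb => i'; rewrite exists_ord_recl /= andbF /=.
  by apply: eq_existsb => k; rewrite !lift_perm_lift !ltn_lift.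
rewrite exists_ord_recl /= existsb_false /=.
case: n j s => [|n] j s.
  by rewrite [j]ord1 ltn0 andbF; apply/existsP => -[[]].
rewrite exists_ord_recl exists_ord_recl /= lift_perm_id !lift_perm_lift ltn_lift_id.
rewrite [X in _ || X](_ : _ = false); last first.
  by apply/existsP => -[i /existsP[k]]; rewrite /bump.
rewrite orbF.
apply/existsP/andP => [[k]|[s0_gt0 s0_lt]].
  rewrite lift_perm_lift ltn_lift => /and3P[_ -> lt_k]; split=> //.
  exact: leq_ltn_trans lt_k.
(* The smallest remaining letter plays the role of 1. *)
exists (s^-1 ord0)%g; rewrite lift_perm_lift ltn_lift permKV s0_gt0 s0_lt /= andbT.
rewrite /bump /= !add1n ltnS lt0n; apply/eqP => s_0.
have eq0: (s^-1)%g ord0 = ord0 by apply: val_inj.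
by rewrite -{1}eq0 permKV in s0_gt0.
Qed.

(** * Gaussian binomials *)

Section GaussianBinomial.
Variables (R : comNzRingType) (q : R).

(** Defined by the q-Pascal rule rather than by factorials, so that it makes
    sense over any ring and vanishes for [k > n]. *)
Fixpoint qbin (n k : nat) : R :=
  match n, k with
  | _, 0%N => 1
  | 0%N, _.+1 => 0
  | n'.+1, k'.+1 => q ^+ k * qbin n' k + qbin n' k'
  end.

Lemma qbin0 n : qbin n 0 = 1. Proof. by case: n. Qed.

Lemma qbin_small n k : (n < k)%N -> qbin n k = 0.
Proof.
elim: n k => [|n IHn] [|k] //=; rewrite ltnS => lt_nk.
by rewrite !IHn ?mulr0 ?addr0 // ltnW.
Qed.

End GaussianBinomial.

Section QFactorial.
Variables (R : comUnitRingType) (q : R).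

Lemma qfactS n : qfact q n.+1 = qfact q n * qint q n.+1.
Proof. by rewrite /qfact big_nat_recr. Qed.

Lemma qfact0 : qfact q 0 = 1. Proof. by rewrite /qfact big_geq. Qed.

Lemma qintD m n : qint q (m + n) = qint q m + q ^+ m * qint q n.
Proof. by rewrite /qint mulrA -mulrDl exprD; congr (_ / _); ring. Qed.

Lemma qbin_qfact n k :
  (k <= n)%N -> qbin q n k * (qfact q k * qfact q (n - k)) = qfact q n.
Proof.
elim: n k => [|n IHn] [|k] // le_kn.
- by rewrite qbin0 qfact0 !mul1r.
- by rewrite qbin0 qfact0 !mul1r subn0.
move: le_kn; rewrite ltnS leq_eqVlt => /predU1P[-> | lt_kn].
  rewrite /= qbin_small // mulr0 add0r !qfactS subnn.
  by rewrite -[in RHS](IHn n) // subnn; ring.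
have eq_nk: (n - k = (n - k.+1).+1)%N by rewrite subnSK.
have IH1 := IHn k.+1 lt_kn; have IH2 := IHn k (ltnW lt_kn).
have -> : qfact q n.+1 = qfact q n * (qint q k.+1 + q ^+ k.+1 * qint q (n - k)).
  by rewrite -qintD qfactS addSn subnKC // ltnW.
rewrite mulrDr -{1}IH2 -IH1 subSS /= eq_nk !qfactS; ring.
Qed.

End QFactorial.

(** * Avoiding permutations behind a prescribed letter *)

Section GeneratingFunction.
Variables (R : comNzRingType) (q t : R).

(** The contribution of the adjacent letters [a], [b] of a Lehmer code: a descent
    is allowed only onto 0, and then it counts [t]. *)
Definition step_weight (a b : nat) : R :=
  if (b < a)%N then (if b == 0%N then t else 0) else 1.

Definition perm_weight n (s : 'S_n) : R :=
  if contains_v321 s then 0 else q ^+ inv_perm s * t ^+ des_perm s.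

(** The letter [a] put in front contributes the descent that it may start, but
    not its own inversions.  For [a = 0] this is the plain generating function
    of the avoiding permutations. *)
Definition avoid_gf n a : R :=
  \sum_(s : 'S_n) step_weight a (first_value s) * perm_weight s.

Lemma perm_weight_lift n (j : 'I_n.+1) (s : 'S_n) :
  perm_weight (lift_perm ord0 j s) =
    q ^+ j * (step_weight j (first_value s) * perm_weight s).
Proof.
rewrite /perm_weight contains_lift_perm inv_lift_perm des_lift_perm /step_weight.
rewrite !exprD lt0n; case: ltnP => _; case: eqP => _ /=; case: ifP => _;
  rewrite ?expr0 ?expr1; ring.
Qed.

Lemma avoid_gf0 n : avoid_gf n 0 = \sum_(s : 'S_n) perm_weight s.
Proof. by apply: eq_bigr => s _; rewrite /step_weight ltn0 mul1r. Qed.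

Lemma avoid_gfS n a :
  avoid_gf n.+1 a = \sum_(j < n.+1) step_weight a j * (q ^+ j * avoid_gf n j).
Proof.
rewrite /avoid_gf (reindex _ (onW_bij _ (@lift_perm_bij n))) /=.
under [RHS]eq_bigr => j _ do rewrite mulrA mulr_sumr.
rewrite pair_big /=; apply: eq_bigr => -[j s] _ /=.
by rewrite lift_perm_id perm_weight_lift; ring.
Qed.

(** The letters [a] and [a.+1] in front differ only in the way they are followed
    by the letter [a]. *)
Lemma avoid_gf_incr n a : (a <= n)%N ->
  avoid_gf n.+1 a = avoid_gf n.+1 a.+1
    + (1 - (if a == 0%N then t else 0)) * (q ^+ a * avoid_gf n a).
Proof.
rewrite -ltnS => lt_an; rewrite !avoid_gfS.
rewrite (bigD1 (Ordinal lt_an)) //= [in RHS](bigD1 (Ordinal lt_an)) //=.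
rewrite (eq_bigr (fun j : 'I_n.+1 => step_weight a.+1 j * (q ^+ j * avoid_gf n j))).
  by rewrite /step_weight ltnn ltnSn; ring.
move=> j; rewrite -val_eqE /= => ne_ja.
by rewrite /step_weight ltnS [(j <= a)%N]leq_eqVlt (negPf ne_ja).
Qed.

(** After a letter [a.+1], the code increases weakly for [k] steps until its
    first 0, where a descent occurs.  These [k] letters form a partition in a box
    of sides [k] and [m - k], shifted by [a.+1], whence the Gaussian binomial;
    beyond the 0 the code is unconstrained. *)
Lemma avoid_gf_pos m a :
  avoid_gf (m + a).+1 a.+1 =
    t * \sum_(k < m.+1) q ^+ (a.+1 * k) * qbin q m k * avoid_gf (m + a - k) 0.
Proof.
elim: m a => [|m IHm] a.
  rewrite big_ord1 avoid_gfS big_ord_recl big1 => [|i _].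
    by rewrite /step_weight /= muln0 subn0 add0n; ring.
  by rewrite /step_weight ltn_ord /= mul0r.
have := IHm a.+1; rewrite addnS addSn => IHm1.
rewrite avoid_gf_incr ?ltnS ?leq_addl // IHm1 IHm subr0 mul1r mulrCA -mulrDr.
congr (_ * _).
(* The summand of the induction hypothesis at [a.+1]; its term of index [m.+1]
   vanishes, so the sum may be split off at either end. *)
pose G k := q ^+ (a.+2 * k) * qbin q m k * avoid_gf ((m + a).+1 - k) 0.
have -> : \sum_(k < m.+1) q ^+ (a.+2 * k) * qbin q m k *
    avoid_gf ((m + a).+1 - k) 0 = G 0%N + \sum_(k < m.+1) G k.+1.
  transitivity (\sum_(k < m.+2) G k); last by rewrite big_ord_recl.
  rewrite [RHS]big_ord_recr /=.
  by rewrite [G m.+1]/G qbin_small // mulr0 mul0r addr0.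
rewrite [RHS]big_ord_recl /= [G 0%N]/G !muln0 !qbin0 -addrA; congr (_ + _).
rewrite mulr_sumr -big_split; apply: eq_bigr => k _.
rewrite /G /bump /= add1n subSS [(a.+2 * _)%N]mulSn !mulnS !exprD; ring.
Qed.

Lemma avoid_gf_rec n :
  avoid_gf n.+1 0 = (1 - t) * avoid_gf n 0
    + t * \sum_(k < n.+1) q ^+ k * qbin q n k * avoid_gf (n - k) 0.
Proof.
rewrite avoid_gf_incr // expr0 mul1r addrC; congr (_ + _).
rewrite -[in LHS](addn0 n) avoid_gf_pos; congr (_ * _).
by apply: eq_bigr => k _; rewrite mul1n addn0.
Qed.

End GeneratingFunction.

(** * Power series *)

Section PowerSeries.
Variable R : comNzRingType.
Implicit Types (f g : {fps R}) (c : R) (n : nat).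

Lemma coef_fpsCM c f n : fps_coef (fpsC c * f) n = c * fps_coef f n.
Proof.
rewrite fps_coefM big_ord_recl subn0 big1 ?addr0 //= => i _.
by rewrite mul0r.
Qed.

Lemma fpsC_exp c k : fpsC (c ^+ k) = fpsC c ^+ k.
Proof.
elim: k => [//|k IHk]; rewrite !exprS -IHk.
by apply: fpsP => n; rewrite coef_fpsCM /=; case: eqP => _; rewrite ?mulr0.
Qed.

Lemma coef_fpsXM f n :
  fps_coef (fpsX * f) n = if n is m.+1 then fps_coef f m else 0.
Proof.
rewrite fps_coefM; case: n => [|n]; first by rewrite big_ord1 mul0r.
rewrite !big_ord_recl big1 => [|i _]; last by rewrite mul0r.
by rewrite mul0r mul1r add0r addr0 /bump /= subSS subn0.
Qed.

Lemma coef_fpsXnM_small k f n : (n < k)%N -> fps_coef (fpsX ^+ k * f) n = 0.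
Proof.
elim: k n => // k IHk [|n] lt_nk; rewrite exprS -mulrA coef_fpsXM //.
exact: IHk.
Qed.

Lemma fps_scale_varM c f g :
  fps_scale_var c (f * g) = fps_scale_var c f * fps_scale_var c g.
Proof.
apply: fpsP => n; rewrite fps_coefM /= mulr_sumr.
apply: eq_bigr => i _; rewrite -{1}(subnKC (leq_ord i)) exprD; ring.
Qed.

Lemma fps_scale_varD c f g :
  fps_scale_var c (f + g) = fps_scale_var c f + fps_scale_var c g.
Proof. by apply: fpsP => n; rewrite /= mulrDr. Qed.

Lemma fps_scale_varC c d : fps_scale_var c (fpsC d) = fpsC d.
Proof.
by apply: fpsP => -[|n]; rewrite /= ?mul1r ?mulr0.
Qed.

Lemma fps_scale_varX c : fps_scale_var c fpsX = fpsC c * fpsX.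
Proof.
by apply: fpsP => -[|[|n]]; rewrite coef_fpsCM /= ?mulr0 ?expr1.
Qed.

Lemma fps_scale_var_scale c d f :
  fps_scale_var c (fps_scale_var d f) = fps_scale_var (c * d) f.
Proof. by apply: fpsP => n; rewrite /= exprMn mulrA. Qed.

Lemma fps_scale_var1 f : fps_scale_var 1 f = f.
Proof. by apply: fpsP => n; rewrite /= expr1n mul1r. Qed.

End PowerSeries.

(** * The functional equation *)

Lemma qint_unit n : qint q_ n.+1 \is a GRing.unit.
Proof.
have unit_1q k : 1 - q_ ^+ k.+1 \is a GRing.unit.
  by rewrite fps_unitE exprS fps_coefD fps_coefN coef_fpsXM subr0 unitr1.
by rewrite unitrM unitrV unit_1q -[q_]expr1 unit_1q.
Qed.

Lemma qfact_unit n : qfact q_ n \is a GRing.unit.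
Proof.
elim: n => [|n IHn]; first by rewrite qfact0 unitr1.
by rewrite qfactS unitrM IHn qint_unit.
Qed.

Lemma qint_mul1q n : (1 - q_) * qint q_ n = 1 - q_ ^+ n.
Proof.
rewrite mulrC divrK // fps_unitE.
by rewrite fps_coefD fps_coefN subr0 unitr1.
Qed.

Lemma I_polyE n : I_poly n = avoid_gf q_ t_ n 0.
Proof.
rewrite avoid_gf0; case: n => [|n].
  rewrite (big_pred1 1%g) => [|s]; last first.
    by symmetry; apply/eqP/permP => -[].
  rewrite /perm_weight inv_permE des_permE !big_ord0 mul1r.
  by rewrite (_ : contains_v321 1 = false) //; apply/existsP => -[[]].
rewrite /I_poly big_mkcond; apply: eq_bigr => s _.
by rewrite /perm_weight if_neg.
Qed.

(** The decomposition of an avoiding permutation at its minimum, [k] being the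
    number of letters before it; the case [k = 0], which has no descent into the
    minimum, accounts for the correction [1 - t_]. *)
Lemma I_poly_rec n :
  I_poly n.+1 = (1 - t_) * I_poly n
    + t_ * \sum_(k < n.+1) q_ ^+ k * qbin q_ n k * I_poly (n - k).
Proof.
rewrite !I_polyE avoid_gf_rec; congr (_ + _ * _).
by apply: eq_bigr => k _; rewrite I_polyE.
Qed.

Definition bracket : Ztqx := fpsC t_ * (fps_scale_var q_ (qexp q_) - 1) + 1.

Definition first_factor : Ztqx := bracket * (fpsC q_ - 1) * x_ + 1.

(** [bracket * I_series] is the q-derivative of [I_series]; this is
    [I_poly_rec] divided by the q-factorial of [n]. *)
Lemma coef_bracket_I n :
  fps_coef (bracket * I_series) n = I_poly n.+1 / qfact q_ n.
Proof.
have -> : bracket * I_series =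
    fpsC t_ * (fps_scale_var q_ (qexp q_) * I_series - I_series) + I_series.
  by rewrite /bracket; set e := fps_scale_var _ _; ring.
rewrite I_poly_rec fps_coefD coef_fpsCM fps_coefD fps_coefN /=.
have -> : \sum_(k < n.+1) q_ ^+ k / qfact q_ k * (I_poly (n - k) / qfact q_ (n - k))
   = (\sum_(k < n.+1) q_ ^+ k * qbin q_ n k * I_poly (n - k)) / qfact q_ n.
  rewrite mulr_suml; apply: eq_bigr => k _.
  rewrite -[LHS]mulrA -2![RHS]mulrA; congr (_ * _).
  apply: (mulIr (qfact_unit n)); rewrite [in RHS]mulrA divrK ?qfact_unit //.
  rewrite -(qbin_qfact q_ (leq_ord k)).
  rewrite [LHS](_ : _ = qbin q_ n k * I_poly (n - k) *
     ((qfact q_ k)^-1 * qfact q_ k) *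
     ((qfact q_ (n - k))^-1 * qfact q_ (n - k))); last by ring.
  by rewrite !mulVr ?qfact_unit // !mulr1.
ring.
Qed.

(** Multiplied by [(1 - q) x], the q-derivative of [I] becomes
    [I(x) - I(q x)]. *)
Lemma first_factor_mul_I : first_factor * I_series = fps_scale_var q_ I_series.
Proof.
have -> : first_factor * I_series =
    x_ * ((fpsC q_ - 1) * (bracket * I_series)) + I_series.
  by rewrite /first_factor; ring.
apply: fpsP => -[|n]; rewrite fps_coefD coef_fpsXM.
  by rewrite add0r /= expr0 mul1r div1r.
rewrite mulrBl mul1r fps_coefD fps_coefN coef_fpsCM coef_bracket_I /=.
have -> : I_poly n.+1 / qfact q_ n =
    qint q_ n.+1 * (I_poly n.+1 / qfact q_ n.+1).
  by rewrite qfactS invrM ?qfact_unit ?qint_unit // mulrCA mulVKr ?qint_unit.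
set c := I_poly _ / _.
have -> : q_ ^+ n.+1 = 1 - (1 - q_) * qint q_ n.+1 by rewrite qint_mul1q; ring.
ring.
Qed.

Lemma scale_first_factor k :
  fps_scale_var (q_ ^+ k) first_factor =
    (fpsC t_ * (fps_scale_var (q_ ^+ k.+1) (qexp q_) - 1) + 1)
      * (fpsC q_ - 1) * fpsC q_ ^+ k * x_ + 1.
Proof.
have scale1 : fps_scale_var (q_ ^+ k) (1 : Ztqx) = 1 by apply: fps_scale_varC.
have scaleN1 : fps_scale_var (q_ ^+ k) (- 1 : Ztqx) = - 1.
  by rewrite -{2}scale1; apply: fpsP => n; apply: mulrN.
have scaleX : fps_scale_var (q_ ^+ k) x_ = fpsC q_ ^+ k * x_.
  by rewrite -fpsC_exp; apply: fps_scale_varX.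
have scaleQ : fps_scale_var (q_ ^+ k) (fpsC q_ - 1) = fpsC q_ - 1.
  by rewrite fps_scale_varD scaleN1 fps_scale_varC.
have scaleB : fps_scale_var (q_ ^+ k) bracket =
    fpsC t_ * (fps_scale_var (q_ ^+ k.+1) (qexp q_) - 1) + 1.
  rewrite /bracket fps_scale_varD scale1 fps_scale_varM fps_scale_varC.
  by rewrite fps_scale_varD scaleN1 fps_scale_var_scale -exprSr.
rewrite /first_factor fps_scale_varD scale1 2!fps_scale_varM scaleX.
rewrite scaleQ scaleB; congr (_ + 1); exact: mulrA.
Qed.

Lemma scale_first_factor_unit k :
  fps_scale_var (q_ ^+ k) first_factor \is a GRing.unit.
Proof.
rewrite scale_first_factor fps_unitE fps_coefD [_ * x_]mulrC coef_fpsXM.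
by rewrite add0r unitr1.
Qed.

(** * The infinite product *)

(** Each factor of the product turns [I(q^(k+1) x)] into [I(q^k x)]. *)
Lemma partial_product_mul_I K :
  \prod_(0 <= k < K) (fps_scale_var (q_ ^+ k) first_factor)^-1
    * fps_scale_var (q_ ^+ K) I_series = I_series.
Proof.
elim: K => [|K IHK]; first by rewrite big_geq // mul1r fps_scale_var1.
have scaleS : fps_scale_var (q_ ^+ K.+1) I_series =
    fps_scale_var (q_ ^+ K) first_factor * fps_scale_var (q_ ^+ K) I_series.
  by rewrite -fps_scale_varM first_factor_mul_I fps_scale_var_scale -exprSr.
rewrite scaleS big_nat_recr //= -[LHS]mulrA mulKr //.
exact: scale_first_factor_unit.
Qed.

(** Only the constant term of [I], which is 1, escapes a factor [q^K]. *)
Lemma scale_I_series K :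
  exists E, fps_scale_var (q_ ^+ K) I_series = 1 + fpsC (q_ ^+ K) * E.
Proof.
exists (\fps_n (if n is m.+1 then (q_ ^+ K) ^+ m * fps_coef I_series n else 0)).
apply: fpsP => -[|n]; rewrite fps_coefD coef_fpsCM /=.
  by rewrite qfact0 divr1 mulr1 mulr0 addr0.
by rewrite add0r exprS -!mulrA.
Qed.

Lemma coef_add_qnM (P E : Ztqx) k n m : (m < k)%N ->
  fps_coef (fps_coef (P + fpsC (q_ ^+ k) * E) n) m = fps_coef (fps_coef P n) m.
Proof.
move=> lt_mk; rewrite fps_coefD coef_fpsCM fps_coefD.
by rewrite coef_fpsXnM_small ?addr0.
Qed.

Theorem theorem3p1 :
  fps2_cvg
    (fun K : nat =>
       \prod_(0 <= k < K)
         ((fpsC t_ * (fps_scale_var (q_ ^+ k.+1) (qexp q_) - 1) + 1)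
            * (fpsC q_ - 1) * fpsC q_ ^+ k * x_ + 1)^-1)
    I_series.
Proof.
move=> n m; exists m.+1 => K lt_mK.
under eq_bigr => k _ do rewrite -scale_first_factor.
have [E I_E] := scale_I_series K.
rewrite -[in RHS](partial_product_mul_I K) I_E mulrDr mulr1 mulrCA.
by rewrite coef_add_qnM.
Qed.
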